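(* Let $d\geq 3$ and let $G$ be a $d$-angulation. Then $G$ admits a $d/(d-2)$-orientation if and only if $G$ has girth $d$. Moreover, if $d=2p$ is even, then every $d$-angulation of girth $d$ admits a $p/(p-1)$-orientation.
   Context: Graphs are finite, have no loops, and may have multiple edges. A plane graph is a connected planar graph together with a crossing-free drawing in the plane; its faces are the connected components of the complement of the drawing. The unbounded face is the external face; vertices and edges incident to it are external, the others are internal. Each edge $e=\{u,v\}$ has two arcs (directions), $(u,e)$ with origin $u$ and $(v,e)$ with origin $v$. A corner is a pair of consecutive edges around a vertex; the degree of a face is its number of incident corners. A $d$-angulation is a plane graph all of whose faces (including the external face) have degree $d$. The girth of a graph is the length of a shortest cycle. For an integer $k\geq 1$, a $k$-fractional orientation of a set of edges assigns to every arc of these edges a value in $\{0,1,\dots,k\}$ such that the two arcs of each edge have values summing to $k$; the outdegree of a vertex is the sum of the values of the arcs having that vertex as origin. A $j/k$-orientation of a plane graph is a $k$-fractional orientation of its internal edges (external edges are not oriented) such that every internal vertex has outdegree $j$ and every external vertex has outdegree $0$.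
   Formalization: The equivalence is stated for d-angulations containing at least one cycle: a plane tree with d/2 edges is a d-angulation with the empty d/(d-2)-orientation but has no cycle, hence not girth d. *)

(* Defs.v *)
From mathcomp Require Import all_boot perm.
Set Implicit Arguments.
Unset Strict Implicit.
Unset Printing Implicit Defensive.

(* Finite loopless multigraphs. The ends of an edge are numbered by booleans, so
   that parallel edges are allowed. *)
Record multigraph := Multigraph {
  vertex : finType;
  edge : finType;
  endpoint : edge -> bool -> vertex;
  no_loop : forall e, endpoint e false != endpoint e true
}.

(* As there are no loops, the arc (u, e) of the edge e = {u, v} is encoded by
   (e, b), where b is the boolean with endpoint e b = u. *)
Definition arc_of (G : multigraph) : finType := (edge G * bool)%type.

Section Multigraph.
Variable G : multigraph.

Definition origin (a : arc_of G) : vertex G := endpoint a.1 a.2.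
Definition opp_arc (a : arc_of G) : arc_of G := (a.1, ~~ a.2).
Definition target (a : arc_of G) : vertex G := origin (opp_arc a).

Lemma opp_arcK : involutive opp_arc.
Proof. by case=> e b; rewrite /opp_arc /= negbK. Qed.

Definition adjacent (u v : vertex G) : bool :=
  [exists a : arc_of G, (origin a == u) && (target a == v)].

Definition connected : Prop := forall u v : vertex G, connect adjacent u v.

(* Simple cycles, as cyclic sequences of arcs. Distinctness of the edges only
   matters in length 2: it rejects an edge followed back and forth, while two
   parallel edges do form a cycle. *)
Definition is_cycle (c : seq (arc_of G)) : bool :=
  [&& c != [::],
      cycle [rel a b | target a == origin b] c,
      uniq [seq origin a | a <- c]
    & uniq [seq a.1 | a <- c]].

Definition has_cycle : Prop := exists c, is_cycle c.

(* A graph without cycles has no girth. *)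
Definition has_girth (g : nat) : Prop :=
  (exists2 c, is_cycle c & size c = g) /\
  (forall c, is_cycle c -> g <= size c).

Section FractionalOrientation.
Variables (k : nat) (S : {set edge G}) (w : {ffun arc_of G -> 'I_k.+1}).

(* Only the values of w on the arcs of the edges in S are relevant. *)
Definition fractional_orientation : Prop :=
  forall e, e \in S -> w (e, false) + w (e, true) = k.

Definition outdegree (v : vertex G) : nat :=
  \sum_(a : arc_of G | (a.1 \in S) && (origin a == v)) w a.

End FractionalOrientation.
End Multigraph.

Section Rotation.
Variables (G : multigraph) (rot : {perm arc_of G}).

(* rot a is the arc that follows a in the cyclic order, clockwise say, of the
   arcs with the same origin. *)
Definition rotation_system : Prop :=
  forall a, porbit rot a = [set b : arc_of G | origin b == origin a].

(* After traversing a, the boundary walk of the face on the left of a goes on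
   along rot (opp_arc a). *)
Definition face_perm : {perm arc_of G} :=
  perm (inj_comp (@perm_inj _ rot) (inv_inj (@opp_arcK G))).

(* A face is represented by the set of arcs having this face on their left. *)
Definition faces : {set {set arc_of G}} := porbits face_perm.

End Rotation.

(* Plane drawings of a connected graph, up to homeomorphism of the plane, are
   encoded by combinatorial maps: a cyclic order of the arcs around each vertex
   such that Euler's formula holds, that is, the surface obtained by gluing a
   disk along each face boundary is a sphere, and the choice of the face that
   contains the point at infinity. The graph reduced to a single vertex, which
   has no arc, is not covered; its only face has no pair of consecutive edges. *)
Record plane_graph := PlaneGraph {
  graph :> multigraph;
  rotation : {perm arc_of graph};
  ext_face : {set arc_of graph};
  plane_connected : connected graph;
  plane_rotation : rotation_system rotation;
  plane_euler : #|vertex graph| + #|faces rotation| = #|edge graph| + 2;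
  ext_face_in : ext_face \in faces rotation
}.

Section PlaneGraph.
Variable G : plane_graph.

(* The corner (a, rotation G a) lies in the face whose boundary walk comes in
   along opp_arc a and goes out along rotation G a. *)
Definition face_degree (F : {set arc_of G}) : nat :=
  #|[set a : arc_of G | rotation G a \in F]|.

Definition d_angulation (d : nat) : Prop :=
  forall F, F \in faces (rotation G) -> face_degree F = d.

Definition ext_vertices : {set vertex G} := [set origin a | a in ext_face G].
Definition ext_edges : {set edge G} := [set a.1 | a in ext_face G].
Definition int_edges : {set edge G} := ~: ext_edges.

Definition jk_orientation (j k : nat) (w : {ffun arc_of G -> 'I_k.+1}) : Prop :=
  [/\ fractional_orientation int_edges w,
      forall v, v \notin ext_vertices -> outdegree int_edges w v = j
    & forall v, v \in ext_vertices -> outdegree int_edges w v = 0].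

Definition admits_orientation (j k : nat) : Prop :=
  exists w : {ffun arc_of G -> 'I_k.+1}, jk_orientation j w.

End PlaneGraph.

(* Main.v *)
Require Import Defs.
From mathcomp Require Import all_boot perm zify.
Set Implicit Arguments.
Unset Strict Implicit.
Unset Printing Implicit Defensive.

(** By Euler's formula, a subgraph with edge set X on the vertex set S has at
    least |X| - |S| + 2 faces; faces of subgraphs are unions of faces of G.

    If G has girth d, the boundary of each face of such a subgraph contains a
    cycle, so that d (|X| - |S| + 2) <= 2 |X|. When S contains the external
    vertices, this is the Hall-type condition for the existence of an
    orientation with the prescribed outdegrees.

    Conversely, let A be the union of the faces of G enclosed by a cycle c,
    made of f faces and containing e edges and v vertices in its interior.
    Then e + 1 <= v + f by Euler's formula and d f = 2 e + |c|; in the presence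
    of a d/(d-2)-orientation, d v <= (d-2) e. Hence d <= |c|. *)

(** * Sets of boolean functions closed under addition modulo 2 *)

Section BooleanFunctions.
Variables (T : finType) (L : {set {ffun T -> bool}}).
Hypothesis addL : forall f g : {ffun T -> bool},
  f \in L -> g \in L -> [ffun x => f x (+) g x] \in L.

(** If some [g] in [L] tells [x] and [y] apart, adding [g] injects the functions that tell them
    apart into those that do not. *)
Lemma card_equalizer_half x y : #|L| <= 2 * #|[set f : {ffun T -> bool} in L | f x == f y]|.
Proof.
rewrite -(cardsID [set f : {ffun T -> bool} | f x == f y] L) mul2n -addnn.
have ->: L :&: [set f : {ffun T -> bool} | f x == f y] =
          [set f : {ffun T -> bool} in L | f x == f y].
  by apply/setP=> f; rewrite !inE.
rewrite leq_add2l.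
have [->|[g]] := set_0Vmem (L :\: [set f : {ffun T -> bool} | f x == f y]); first by rewrite cards0.
rewrite !inE => /andP[gxy gL].
pose s (f : {ffun T -> bool}) : {ffun T -> bool} := [ffun z => f z (+) g z].
have s_inj : injective s.
  by move=> f1 f2 /ffunP e; apply/ffunP=> z; have:= e z; rewrite !ffunE => /addIb.
rewrite -(card_imset _ s_inj); apply/subset_leq_card/subsetP=> _ /imsetP[f + ->].
rewrite !inE => /andP[fxy fL]; rewrite addL // !ffunE.
by move: gxy fxy; case: (f x) (f y) (g x) (g y) => [] [] [] [].
Qed.

End BooleanFunctions.

(** * Functions on the components of a subgraph; cycles within a set of arcs *)

Section Multigraph.
Variable G : multigraph.
Implicit Types (a b : arc_of G) (e : edge G) (X : {set edge G}).

Lemma same_edge a b : a.1 = b.1 -> a = b \/ a = opp_arc b.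
Proof. by case: a b => [e []] [e' []] /= ->; auto. Qed.

Lemma sum_arcs (F : arc_of G -> nat) :
  \sum_a F a = \sum_e (F (e, false) + F (e, true)).
Proof.
rewrite (eq_bigr (fun e => \sum_(b : bool) F (e, b))) ?pair_big.
  by apply: eq_bigr => -[].
by move=> e _; rewrite big_bool addnC.
Qed.

Definition vert_fun X : {set {ffun vertex G -> bool}} :=
  [set h : {ffun vertex G -> bool} |
    [forall a : arc_of G, (a.1 \in X) ==> (h (target a) == h (origin a))]].

Lemma vert_funP X (h : {ffun vertex G -> bool}) :
  reflect (forall a, a.1 \in X -> h (target a) = h (origin a)) (h \in vert_fun X).
Proof.
rewrite inE; apply: (iffP forallP) => hX a; first by move=> /(implyP (hX a))/eqP.
by apply/implyP => /hX ->.
Qed.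

Lemma vert_fun_add X (f g : {ffun vertex G -> bool}) :
  f \in vert_fun X -> g \in vert_fun X -> [ffun x => f x (+) g x] \in vert_fun X.
Proof. by move=> /vert_funP hf /vert_funP hg; apply/vert_funP=> a aX; rewrite !ffunE hf ?hg. Qed.

Lemma vert_funU1 X e :
  vert_fun (e |: X) = [set h : {ffun vertex G -> bool} in vert_fun X |
                     h (origin (e, false)) == h (origin (e, true))].
Proof.
apply/setP=> h; rewrite [RHS]inE; apply/vert_funP/andP => [hX|[/vert_funP hX /eqP he] [e' b]].
  split; first by apply/vert_funP=> a aX; apply: hX; rewrite !inE aX orbT.
  by rewrite eq_sym (hX (e, false)) // setU11.
rewrite !inE => /orP[/eqP/= -> | /hX //].
by rewrite /target /opp_arc /=; case: b; rewrite he.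
Qed.

(** Vertices outside [S] are isolated in the subgraph, so values there are free; one more free value
    is shared by all of [S]. *)
Lemma card_vert_fun X (S : {set vertex G}) :
  S != set0 -> (forall a, a.1 \in X -> origin a \in S) ->
  2 ^ (#|vertex G|.+1 - #|S|) <= #|vert_fun X|.
Proof.
case/set0Pn=> s sS XS.
have cS : #|~: S :|: [set s]| = #|vertex G|.+1 - #|S|.
  by rewrite setUC cardsU1 in_setC sS -(cardsC S) /=; lia.
rewrite -cS -card_powerset.
(* The membership of [s] in [U] encodes the common value on [S]. *)
pose t (U : {set vertex G}) : {ffun vertex G -> bool} :=
  [ffun v => if v \in S then s \in U else v \in U].
have t_inj : {in powerset (~: S :|: [set s]) &, injective t}.
  move=> U1 U2; rewrite !inE => /subsetP s1 /subsetP s2 /ffunP e; apply/setP => v.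
  have := e v; rewrite !ffunE; case: ifP => // vS.
  have [-> //|vs _] := eqVneq v s.
  by apply/idP/idP => [/s1|/s2]; rewrite !inE vS (negbTE vs).
rewrite -(card_in_imset t_inj); apply/subset_leq_card/subsetP=> _ /imsetP[U _ ->].
apply/vert_funP=> a aX; rewrite !ffunE (XS _ aX) /target XS //.
Qed.

(* The hypothesis on opposite arcs makes the edges of a closed walk in [Y]
   distinct as soon as its vertices are. *)
Lemma cycle_in_arcs (Y : {set arc_of G}) :
  Y != set0 -> (forall a, a \in Y -> opp_arc a \notin Y) ->
  (forall a, a \in Y -> exists2 b, b \in Y & origin b = target a) ->
  exists2 c, is_cycle c & {subset c <= Y}.
Proof.
case/set0Pn=> a0 a0Y oppY nextY.
pose nxt v := odflt a0 [pick b | (b \in Y) && (origin b == v)].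
have nxtY v : nxt v \in Y by rewrite /nxt; case: pickP => //= b /andP[].
have onxt v : (exists2 b, b \in Y & origin b = v) -> origin (nxt v) = v.
  case=> b bY ov; rewrite /nxt; case: pickP => /= [b' /andP[_ /eqP]//|/(_ b)].
  by rewrite bY ov eqxx.
pose f v := target (nxt v).
have ofx v : origin (nxt (f v)) = f v by apply: onxt; apply: nextY.
(* Iterating [f] from any vertex is eventually periodic, and [y] lies on the periodic part. Starting
   from an image of [f] ensures that [nxt] never falls back on its default [a0] along the way. *)
pose v0 := f (origin a0); pose n := order f v0.
have /trajectP[i lt_in ei] : iter n f v0 \in traject f v0 n.
  by have := looping_order f v0; rewrite /looping.
pose y := iter i f v0.
have oiter m x : origin (nxt (iter m f (f x))) = iter m f (f x).
  by elim: m => [|m IH] /=; apply: ofx.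
have cyc_y : fcycle f (orbit f y).
  apply/(orbitPcycle 0 3); exists (n - i).-1.
  by rewrite prednK ?subn_gt0 // -iterD subnK // ltnW.
have oy v : v \in orbit f y -> origin (nxt v) = v.
  by rewrite -fconnect_orbit => /iter_findex <-; rewrite /y -iterD; apply: oiter.
exists [seq nxt v | v <- orbit f y]; last by move=> _ /mapP[v _ ->].
have uo : uniq [seq origin a | a <- [seq nxt v | v <- orbit f y]].
  rewrite -map_comp (eq_in_map (_ \o _) id _).1 ?map_id ?orbit_uniq //.
apply/and4P; split=> //.
- by rewrite -size_eq0 size_map size_orbit /order -lt0n; apply/card_gt0P; exists y; apply: connect0.
- apply: (homo_cycle_in (P := mem (orbit f y)) _ _ cyc_y); last exact/allP.
  by move=> u v _ vy /=; rewrite (oy _ vy).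
rewrite map_inj_in_uniq; first exact: map_uniq uo.
move=> a b /mapP[u _ ->] /mapP[v _ ->] /same_edge[//|e].
by have := oppY _ (nxtY v); rewrite -e nxtY.
Qed.

End Multigraph.

(** * Faces of subgraphs and Euler's inequality *)

Section PlaneGraph.
Variable G : plane_graph.
Implicit Types (a b : arc_of G) (e : edge G) (X : {set edge G}).
Implicit Types (g : {ffun arc_of G -> bool}).

Notation rot := (rotation G).
Notation fperm := (face_perm rot).

Lemma origin_rot a : origin (rot a) = origin a.
Proof.
have: rot a \in porbit rot a by exact: mem_porbit 1 a.
by rewrite (plane_rotation (p := G)) inE => /eqP.
Qed.

Lemma face_permE a : fperm a = rot (opp_arc a).
Proof. by rewrite permE. Qed.

Lemma origin_face_perm a : origin (fperm a) = target a.
Proof. by rewrite face_permE origin_rot. Qed.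

(** Induction around a vertex: [rot] permutes transitively the arcs with a given origin. *)
Lemma rot_closed (P : pred (arc_of G)) a b :
  (forall c, origin c = origin a -> P c -> P (rot c)) ->
  origin b = origin a -> P a -> P b.
Proof.
move=> cl ob Pa.
have /porbitP[i ->] : b \in porbit rot a by rewrite (plane_rotation (p := G)) inE ob.
suff: origin ((rot ^+ i)%g a) = origin a /\ P ((rot ^+ i)%g a) by case.
elim: i => [|i [oi Pi]]; first by rewrite perm1.
by rewrite expgSr permM origin_rot; split=> //; apply: cl.
Qed.

(* Two-valued functions on the faces of the subgraph with edge set X: a face of
   this subgraph is a class of faces of G merged across the edges outside X. *)
Definition face_fun X : {set {ffun arc_of G -> bool}} :=
  [set g : {ffun arc_of G -> bool} |
    [forall a, (g (fperm a) == g a) && ((a.1 \in X) || (g (opp_arc a) == g a))]].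

Lemma face_funP X g :
  reflect ((forall a, g (fperm a) = g a) /\
           (forall a, a.1 \notin X -> g (opp_arc a) = g a)) (g \in face_fun X).
Proof.
rewrite inE; apply: (iffP forallP) => [gX|[g1 g2] a].
  split=> a; have /andP[/eqP// _ gX2] := gX a.
  by move=> /negbTE aX; rewrite aX in gX2; apply/eqP.
by rewrite g1 eqxx; case: (boolP (a.1 \in X)) => //= /g2 ->.
Qed.

Lemma face_fun_rot X g a : g \in face_fun X -> g (rot a) = g (opp_arc a).
Proof. by case/face_funP => gf _; rewrite -(gf (opp_arc a)) face_permE opp_arcK. Qed.

Lemma face_fun_add X (f g : {ffun arc_of G -> bool}) :
  f \in face_fun X -> g \in face_fun X -> [ffun x => f x (+) g x] \in face_fun X.
Proof.
move=> /face_funP[f1 f2] /face_funP[g1 g2]; apply/face_funP.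
by split=> a *; rewrite !ffunE ?f1 ?g1 ?f2 ?g2.
Qed.

(** Dual to [vert_funU1]: deleting [e] merges the faces on its two sides. *)
Lemma face_funU1 X e : e \notin X ->
  face_fun X = [set g : {ffun arc_of G -> bool} in face_fun (e |: X) |
                 g (e, false) == g (e, true)].
Proof.
move=> eX; apply/setP=> g; rewrite [RHS]inE.
apply/face_funP/andP => [[g1 g2]|[/face_funP[g1 g2] /eqP ge]].
  split; last by rewrite -(g2 (e, false)).
  by apply/face_funP; split=> // a; rewrite !inE negb_or => /andP[_ /g2].
split=> // a aX; have [ae|ae] := eqVneq a.1 e; last by rewrite g2 // !inE negb_or ae.
by case: a ae {aX} => e' [] /= ->; rewrite /opp_arc /= ge.
Qed.

(* The edges on which g changes form a cycle modulo 2, those on which h changes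
   a cut: their intersection has even size, hence is not reduced to e. *)
Lemma cycle_cut_parity X e g (h : {ffun vertex G -> bool}) :
  e \notin X -> g \in face_fun (e |: X) -> h \in vert_fun X ->
  g (e, false) = g (e, true) \/ h (origin (e, false)) = h (origin (e, true)).
Proof.
move=> eX gX hX.
pose D a := g a (+) g (opp_arc a).
(* Around each vertex, [g (opp_arc a)] is [g (rot a)], so both halves of the sum agree after
   reindexing by [rot]. *)
have D0 : \big[addb/false]_(a | h (origin a)) D a = false.
  rewrite big_split /= [X in _ (+) X](eq_bigr (fun a => g (rot a))).
    rewrite [X in X (+) _](reindex_inj (@perm_inj _ rot)) /=.
    by rewrite (eq_bigl (fun a => h (origin a))) ?addbb // => a; rewrite origin_rot.
  by move=> a _; rewrite (face_fun_rot _ gX).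
move: D0; rewrite big_mkcond.
rewrite (eq_bigr (fun a => h (origin a) && D a)); last by move=> a _; case: (h _).
rewrite (eq_bigr (fun p : arc_of G => (fun i j => h (origin (i, j)) && D (i, j)) p.1 p.2));
  last by case.
(* Now the sum is grouped by edges. An edge other than [e] contributes nothing: if it is in [X], [h]
   agrees at its ends and its two terms cancel; otherwise [g] does not change across it. *)
rewrite -(pair_bigA _ (fun i j => h (origin (i, j)) && D (i, j))) /= (bigD1 e) //=.
rewrite [X in _ (+) X]big1 => [|e' e'e]; rewrite big_bool /= /D /opp_arc /=.
  rewrite addbF; do 2 case: (h _); do 2 case: (g _); auto.
have [e'X|e'X] := boolP (e' \in X).
  have /vert_funP/(_ (e', false) e'X) := hX; rewrite /target /opp_arc /= => ->.
  by case: (h _); do 2 case: (g _).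
have /face_funP[_ /(_ (e', false))] := gX; rewrite !inE negb_or e'e => /(_ e'X).
by rewrite /opp_arc /= => ->; do 2 case: (h _); case: (g _).
Qed.

Lemma card_face_fun_setT : 2 ^ #|faces rot| <= #|face_fun setT|.
Proof.
rewrite -card_powerset.
pose s (U : {set {set arc_of G}}) : {ffun arc_of G -> bool} :=
  [ffun a => porbit fperm a \in U].
have s_inj : {in powerset (faces rot) &, injective s}.
  move=> U1 U2; rewrite !inE => /subsetP s1 /subsetP s2 /ffunP e; apply/setP => F.
  have [/imsetP[a _ ->]|nF] := boolP (F \in faces rot).
    by have := e a; rewrite !ffunE.
  by apply/idP/idP => [/s1|/s2]; rewrite (negbTE nF).
rewrite -(card_in_imset s_inj); apply/subset_leq_card/subsetP=> _ /imsetP[U _ ->].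
apply/face_funP; split=> a; last by rewrite inE.
rewrite !ffunE; congr (_ \in U); apply/eqP.
by rewrite eq_porbit_mem; exact: mem_porbit 1 a.
Qed.

Lemma constant_on_vertices (h : vertex G -> bool) :
  (forall a, h (target a) = h (origin a)) -> forall u v, h u = h v.
Proof.
move=> hc u v.
have cl : closed (@adjacent G) h.
  by move=> x y /existsP[a /andP[/eqP<- /eqP<-]]; rewrite !unfold_in hc.
by have := closed_connect cl (plane_connected u v); rewrite !unfold_in.
Qed.

(** Passing from [a] to [rot a] crosses an edge and then follows a face, so [g] is constant around
    each vertex. It thus induces a function on vertices, constant by connectedness. *)
Lemma opp_invariant_const X g :
  g \in face_fun X -> (forall a, g (opp_arc a) = g a) -> forall a b, g a = g b.
Proof.
move=> gX go.
have gv a b : origin a = origin b -> g a = g b.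
  move=> ab; apply/eqP; apply: (@rot_closed (fun c => g a == g c) a b) => // c _ /eqP->.
  by rewrite (face_fun_rot _ gX) go.
pose h v := [exists a : arc_of G, (origin a == v) && g a].
have hE a : h (origin a) = g a.
  apply/existsP/idP => [[b /andP[/eqP/gv <-]]//|ga]; by exists a; rewrite eqxx.
have hc : forall a, h (target a) = h (origin a) by move=> a; rewrite !hE go.
by move=> a b; rewrite -!hE; apply: constant_on_vertices hc _ _.
Qed.

(* The orders of [face_fun X] and [vert_fun X] are 2 to the numbers of faces and
   of connected components: this is one half of Euler's formula for the
   subgraph with edge set X. When an edge is removed, at most one of the two
   numbers changes, by [cycle_cut_parity]. *)
Lemma card_vert_face_fun X :
  2 ^ #|X|.+1 * #|vert_fun X| <= 2 ^ #|vertex G| * #|face_fun X|.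
Proof.
move En : #|~: X| => n; elim: n X En => [|n IH] X En.
  (* For the whole graph, [vert_fun] contains only the two constants and Euler's formula
     concludes. *)
  have -> : X = setT by apply: setC_inj; rewrite setCT; apply/eqP; rewrite -cards_eq0 En.
  apply: leq_trans (leq_mul (leqnn _) card_face_fun_setT).
  rewrite -expnD (plane_euler G) cardsT addn2 (expnS 2 #|edge G|.+1) mulnC leq_mul2r.
  apply/orP; right.
  pose s (b : bool) : {ffun vertex G -> bool} := [ffun=> b].
  apply: (@leq_trans #|[set s b | b : bool]|); last first.
    by rewrite (leq_trans (leq_imset_card _ _)) ?card_bool.
  apply/subset_leq_card/subsetP => h /vert_funP hX; apply/imsetP.
  have /imsetP[a0 _ _] : ext_face G \in faces rot := ext_face_in G.
  exists (h (origin a0)) => //; apply/ffunP => v; rewrite ffunE.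
  by apply: constant_on_vertices => a; apply: hX; rewrite inE.
have [e] : exists e, e \in ~: X by apply/set0Pn; rewrite -cards_eq0 En.
rewrite inE => eX.
have : #|~: (e |: X)| = n.
  by rewrite setCU setIC -setDE; have := cardsD1 e (~: X); rewrite En inE eX => -[].
move=> /IH; rewrite cardsU1 eX /= add1n [2 ^ _.+2]expnS => {}IH.
have hV := card_equalizer_half (@vert_fun_add _ X) (origin (e, false)) (origin (e, true)).
have hF := card_equalizer_half (@face_fun_add (e |: X)) (e, false) (e, true).
rewrite -vert_funU1 -face_funU1 // in hV hF.
(* Either no function separates the two sides of [e], and only the bound [hV] costs a factor 2; or
   some [g] does, and by parity [vert_fun] is unchanged, so only [hF] costs one. *)
have [/subsetP fs|/subsetPn[g gX ngX]] := boolP (face_fun (e |: X) \subset face_fun X).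
  have fc := subset_leq_card (introT subsetP fs).
  apply: leq_trans (leq_mul (leqnn _) hV) (leq_trans _ (leq_mul (leqnn _) fc)).
  by rewrite mulnCA mulnA.
suff vs : vert_fun X \subset vert_fun (e |: X).
  rewrite -(leq_pmul2l (_ : 0 < 2)) // mulnA.
  apply: leq_trans (leq_mul (leqnn _) (subset_leq_card vs)) (leq_trans IH _).
  by rewrite mulnCA leq_mul.
apply/subsetP=> h hX; rewrite vert_funU1 inE hX /=.
have [ge|-> //] := cycle_cut_parity eX gX hX.
by move: ngX; rewrite (face_funU1 eX) inE gX ge eqxx.
Qed.

(** Exponential form of the bound |X| - |S| + 2 on the number of faces of the subgraph. *)
Lemma card_face_fun X (S : {set vertex G}) :
  S != set0 -> (forall a, a.1 \in X -> origin a \in S) ->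
  2 ^ #|X|.+2 <= 2 ^ #|S| * #|face_fun X|.
Proof.
move=> S0 XS; have h1 := card_vert_fun S0 XS; have h2 := card_vert_face_fun X.
have SV := max_card [in S].
have e1 : 2 ^ #|vertex G|.+1 = 2 ^ #|S| * 2 ^ (#|vertex G|.+1 - #|S|).
  by rewrite -expnD subnKC // ltnW.
rewrite -(leq_pmul2l (_ : 0 < 2 ^ #|vertex G|)) ?expn_gt0 // [leqRHS]mulnCA.
apply: (@leq_trans (2 ^ #|S| * (2 ^ #|X|.+1 * 2 ^ (#|vertex G|.+1 - #|S|)))); last first.
  by rewrite leq_mul //; apply: leq_trans h2; rewrite leq_mul.
by rewrite mulnCA -e1 -!expnD leq_exp2l //; lia.
Qed.

(** The arcs with [g] true on the left and false on the right can always be continued. If none left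
    the target of such an arc [c], the value true would propagate by rotation from [fperm c] to
    [opp_arc c]. *)
Lemma boundary_cycle X g : g \in face_fun X ->
  (exists a b, g a != g b) ->
  exists2 c, is_cycle c & {subset c <= [set a | g a && ~~ g (opp_arc a)]}.
Proof.
move=> gX [a [b ab]]; set Y := [set a | _].
apply: cycle_in_arcs.
- apply: contraNneq ab => Y0; apply/eqP; apply: (opp_invariant_const gX).
  have gY c : g c -> g (opp_arc c).
    by move=> gc; apply: contraT => ngc; rewrite -(in_set0 c) -Y0 inE gc.
  by move=> c; apply/idP/idP => /gY //; rewrite opp_arcK.
- by move=> c; rewrite !inE opp_arcK => /andP[-> /negbTE->].
move=> c; rewrite inE => /andP[gc ngc].
have [/existsP[x /andP[xY /eqP ox]]|/existsPn no] :=
  boolP [exists x, (x \in Y) && (origin x == target c)]; first by exists x.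
suff : g (opp_arc c) by rewrite (negbTE ngc).
apply: (@rot_closed g (fperm c)) => [x ox gx||].
- have := no x; rewrite ox origin_face_perm eqxx andbT inE gx /= negbK.
  by rewrite (face_fun_rot _ gX).
- by rewrite origin_face_perm.
- by have /face_funP[-> _] := gX.
Qed.

End PlaneGraph.

(** * Fractional orientations with prescribed outdegrees *)

Section FractionalOrientation.
Variables (G : multigraph) (k : nat) (S : {set edge G}).
Implicit Types (a b : arc_of G) (w : {ffun arc_of G -> 'I_k.+1}).
Implicit Types (u v x y : vertex G) (U : {set vertex G}).

Definition induced_edges U : {set edge G} :=
  [set e | (origin (e, false) \in U) && (origin (e, true) \in U)].

Lemma fractional_arc w a :
  fractional_orientation S w -> a.1 \in S -> w a + w (opp_arc a) = k.
Proof. by case: a => e [] wS /wS; rewrite /opp_arc /= // addnC. Qed.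

Lemma sum_eq_op (P : pred (arc_of G)) a : \sum_(b | P b) (b == a : nat) = P a.
Proof.
rewrite big_mkcond (bigD1 a) //= eqxx big1 ?addn0 => [|b /negbTE ->]; by case: ifP.
Qed.

Lemma shift_arc w a : fractional_orientation S w -> a.1 \in S -> 0 < w a ->
  exists w', [/\ fractional_orientation S w',
    forall v, outdegree S w' v + (v == origin a) = outdegree S w v + (v == target a)
    & forall b, origin b != origin a -> w b <= w' b].
Proof.
move=> wS aS wa; have wk := fractional_arc wS aS.
(* Both uses of [inord] stay in range: since [w a] is positive and the two values sum to [k], the
   value of [opp_arc a] is less than [k]. *)
pose w' := [ffun b => if b == a then inord (w a).-1
                      else if b == opp_arc a then inord (w b).+1 else w b].
have w'E b : w' b + (b == a) = w b + (b == opp_arc a).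
  rewrite ffunE; have [->|ba] := eqVneq b a.
    rewrite inordK; last by lia.
    have /negbTE -> : a != opp_arc a by apply/eqP; case: (a) => e [] [].
    by lia.
  by have [->|bo] := eqVneq b (opp_arc a); rewrite ?inordK; lia.
have oo a1 a2 : (opp_arc a1 == a2) = (a1 == opp_arc a2).
  by rewrite -(inj_eq (inv_inj (@opp_arcK G))) opp_arcK.
exists w'; split=> [e eS|v|b ba].
- have := w'E (e, true); have := w'E (e, false); have := wS e eS.
  rewrite -!oo /opp_arc /=; lia.
- rewrite /outdegree.
  have -> : (v == origin a : nat) = \sum_(b | (b.1 \in S) && (origin b == v)) (b == a).
    by rewrite sum_eq_op aS eq_sym.
  have -> : (v == target a : nat) =
      \sum_(b | (b.1 \in S) && (origin b == v)) (b == opp_arc a).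
    by rewrite sum_eq_op /= aS eq_sym.
  by rewrite -!big_split; apply: eq_bigr => b _; apply: w'E.
have := w'E b; have /negbTE -> : b != a by apply: contraNneq ba => ->.
by lia.
Qed.

Definition residual w : rel (vertex G) := fun x y =>
  [exists a : arc_of G, [&& a.1 \in S, origin a == x, target a == y & 0 < w a]].

(** Shifting along the first arc can only lower values of arcs with origin [u]. A simple path does
    not return to [u], so its remainder stays residual. *)
Lemma shift_path w u p : fractional_orientation S w ->
  path (residual w) u p -> uniq (u :: p) ->
  exists2 w' : {ffun arc_of G -> 'I_k.+1}, fractional_orientation S w' &
    forall v, outdegree S w' v + (v == u) = outdegree S w v + (v == last u p).
Proof.
elim: p w u => [|x p IH] w u wS; first by exists w.
move=> /= /andP[/existsP[a /and4P[aS /eqP ou /eqP tx wa]] xp] /andP[uxp uniq_xp].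
have [w1 [w1S w1o w1b]] := shift_arc wS aS wa.
have [|w2 w2S w2o] := IH w1 x w1S _ uniq_xp.
  apply: (sub_in_path (P := [pred z | z != u])) xp => [y z yu _|].
    case/existsP=> b /and4P[bS /eqP oy tz wb]; apply/existsP; exists b.
    by rewrite bS tz oy eqxx /= (leq_trans wb) // w1b // oy ou.
  by apply/allP=> z zp /=; apply: contraNneq uxp => <-.
exists w2 => // v; have := w2o v; have := w1o v; rewrite ou tx; lia.
Qed.

Lemma sum_outdegree w U :
  \sum_(v in U) outdegree S w v = \sum_(a | (a.1 \in S) && (origin a \in U)) w a.
Proof.
rewrite /outdegree (exchange_big_dep (fun a => (a.1 \in S) && (origin a \in U))) /=.
  apply: eq_bigr => a /andP[aS aU]; rewrite (big_pred1 (origin a)) // => v.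
  rewrite aS /= andbC eq_sym; by have [->|] := eqVneq v (origin a); rewrite ?aU.
by move=> v a vU /andP[-> /eqP->].
Qed.

Lemma sum_fractional w (X : {set edge G}) : fractional_orientation S w ->
  X \subset S -> \sum_(a | a.1 \in X) w a = k * #|X|.
Proof.
move=> wS /subsetP XS; rewrite big_mkcond sum_arcs /= mulnC -sum_nat_const [RHS]big_mkcond.
by apply: eq_bigr => e _; case: ifP => // /XS/wS.
Qed.

(* Starting from any fractional orientation, units of flow are shifted along
   residual paths from vertices of excessive outdegree to deficient ones. When
   no such path exists, the set of vertices reachable from an excessive vertex
   violates the hypothesis. *)
Lemma fractional_orientation_exists (alpha : vertex G -> nat) :
  (forall U, k * #|induced_edges U :&: S| <= \sum_(v in U) alpha v) ->
  \sum_v alpha v = k * #|S| ->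
  exists2 w : {ffun arc_of G -> 'I_k.+1}, fractional_orientation S w &
    forall v, outdegree S w v = alpha v.
Proof.
move=> hall total.
(* The subtraction is truncated: deficient vertices count for 0, so shifting one unit from an
   excessive to a deficient vertex decreases the sum. *)
pose excess w := \sum_v (outdegree S w v - alpha v).
have [w0 w0S] : exists w : {ffun arc_of G -> 'I_k.+1}, fractional_orientation S w.
  exists [ffun a => if a.2 then ord0 else ord_max] => e _.
  by rewrite !ffunE /= addn0.
move En : (excess w0) => n; elim/ltn_ind: n w0 w0S En => n IH w wS En.
have [/existsP[u ou]|/existsPn no] := boolP [exists u, alpha u < outdegree S w u]; last first.
  exists w => // v; apply/eqP; rewrite eqn_leq leqNgt no /= leqNgt; apply/negP => lt_v.
  have : \sum_v outdegree S w v < \sum_v alpha v.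
    rewrite (bigD1 v) //= [ltnRHS](bigD1 v) //= -addSn leq_add //.
    by apply: leq_sum => x _; rewrite leqNgt no.
  rewrite total -(sum_fractional wS (subxx S)).
  have := sum_outdegree w setT.
  rewrite (eq_bigl xpredT) => [->|x]; last by rewrite inE.
  by rewrite (eq_bigl (fun a => a.1 \in S)) ?ltnn // => a; rewrite inE andbT.
pose R := [set v | connect (residual w) u v].
have [/existsP[y /andP[yR oy]]|/existsPn no] :=
  boolP [exists y, (y \in R) && (outdegree S w y < alpha y)].
  move: yR; rewrite inE => /connectP[p0 /shortenP[p pu up _ ylast]].
  have [w' w'S w'o] := shift_path wS pu up.
  apply: (IH _ _ w' w'S erefl); rewrite -En /excess.
  have uy : u != y by apply: contraTneq oy => <-; rewrite -leqNgt ltnW.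
  rewrite (bigD1 u) //= [ltnRHS](bigD1 u) //= -addSn leq_add //.
    by have := w'o u; rewrite -ylast eqxx (negbTE uy); lia.
  apply: leq_sum => v vu; have := w'o v; rewrite -ylast (negbTE vu).
  by have [->|] := eqVneq v y; lia.
have uR : u \in R by rewrite inE connect0.
(* No vertex of [R] is deficient and [u] is excessive. Arcs leaving [R] have value 0, so all the
   outdegree in [R] comes from induced edges, against [hall]. *)
have : \sum_(v in R) alpha v < \sum_(v in R) outdegree S w v.
  rewrite (bigD1 u) //= [ltnRHS](bigD1 u) //= -addSn leq_add //.
  by apply: leq_sum => x /andP[xR _]; have := no x; rewrite xR /= -leqNgt.
rewrite ltnNge sum_outdegree => /negP[]; apply: leq_trans (hall R).
rewrite -(sum_fractional wS (subsetIr _ _)).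
rewrite [leqRHS]big_mkcond [leqLHS]big_mkcond; apply: leq_sum => a _.
case: ifP => // /andP[aS aR]; rewrite !inE aS andbT.
have [/= |] := boolP (target a \in R).
  rewrite /target /opp_arc in aR *; move: aR; rewrite !inE.
  by case: (a) => e [] /= -> ->.
move=> taR; case: (posnP (w a)) => [->|wa] //.
case/negP: taR; move: aR; rewrite !inE => /connect_trans; apply; apply: connect1.
by apply/existsP; exists a; rewrite aS !eqxx.
Qed.

End FractionalOrientation.

(** * Cycles, faces and their counting *)

Section Faces.
Variable G : plane_graph.
Implicit Types (a b : arc_of G) (e : edge G) (X : {set edge G}).
Implicit Types (g : {ffun arc_of G -> bool}) (F : {set arc_of G}).

Notation rot := (rotation G).
Notation fperm := (face_perm rot).

Lemma face_degreeE F : face_degree F = #|F|.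
Proof. by rewrite -(card_preimset F (@perm_inj _ rot)). Qed.

Lemma face_fun_const X g F a b :
  g \in face_fun X -> F \in faces rot -> a \in F -> b \in F -> g a = g b.
Proof.
case/face_funP=> gf _ /imsetP[c _ ->].
suff gc x : x \in porbit fperm c -> g x = g c by move=> /gc -> /gc ->.
case/porbitP=> i ->; elim: i => [|i IH]; first by rewrite perm1.
by rewrite expgSr permM gf.
Qed.

Lemma face_indicator F : F \in faces rot ->
  [ffun a => a \in F] \in face_fun [set a.1 | a in F].
Proof.
move=> /imsetP[c _ ->]; apply/face_funP; split=> a; rewrite !ffunE.
  by rewrite porbit_sym [RHS]porbit_sym -(porbit_perm _ 1 a) expg1.
move=> aF; have no b : b.1 = a.1 -> b \notin porbit fperm c.
  by move=> ba; apply: contra aF => bF; rewrite -ba; apply: imset_f.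
by rewrite (negbTE (no a _)) ?(negbTE (no (opp_arc a) _)).
Qed.

Lemma face_fun_nonconst X : 2 < #|face_fun X| ->
  exists2 g : {ffun arc_of G -> bool}, g \in face_fun X & exists a b, g a != g b.
Proof.
move=> X2; pose K := [set [ffun=> b] | b : bool] : {set {ffun arc_of G -> bool}}.
have [XK|/subsetPn[g gX gK]] := boolP (face_fun X \subset K).
  have := leq_trans X2 (leq_trans (subset_leq_card XK) (leq_imset_card _ _)).
  by rewrite card_bool.
exists g => //; have /imsetP[a0 _ _] : ext_face G \in faces rot := ext_face_in G.
exists a0; have [/existsP//|/existsPn no] := boolP [exists b, g a0 != g b].
case/imsetP: gK; exists (g a0) => //; apply/ffunP => b; rewrite ffunE.
by apply/eqP; rewrite eq_sym -[_ == _]negbK no.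
Qed.

Lemma uniq_cycle (c : seq (arc_of G)) : is_cycle c -> uniq c.
Proof. by case/and4P=> _ _ /map_uniq. Qed.

Lemma card_map_arcs (T : finType) (f : arc_of G -> T) (c : seq (arc_of G)) :
  uniq [seq f a | a <- c] -> #|[set f a | a in c]| = size c.
Proof.
move=> uc; rewrite -(size_map f) -(card_uniqP uc); apply: eq_card => x.
by apply/imsetP/mapP => -[a ac ->]; exists a.
Qed.

(** A weak Jordan curve theorem: a cycle has as many vertices as edges, so [card_face_fun] provides
    at least four functions, two of them not constant. *)
Lemma cycle_separates (c : seq (arc_of G)) : is_cycle c ->
  exists2 g : {ffun arc_of G -> bool}, g \in face_fun [set a.1 | a in c] &
    exists a b, g a != g b.
Proof.
case/and4P=> c0 cyc uo ue; apply: face_fun_nonconst.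
have Xc : forall a, a.1 \in [set a.1 | a in c] -> origin a \in [set origin a | a in c].
  move=> a /imsetP[b bc /same_edge[->|->]]; first exact: imset_f.
  have /= /eqP tb := next_cycle cyc bc; rewrite -/(target b) tb.
  apply/imsetP; exists (next c b) => //.
  by rewrite mem_next.
have S0 : [set origin a | a in c] != set0.
  case: c c0 {cyc uo ue Xc} => // a c _; apply/set0Pn; exists (origin a).
  by apply: imset_f; rewrite mem_head.
have := card_face_fun S0 Xc; rewrite !card_map_arcs // !expnS.
by rewrite mulnA [leqLHS]mulnC leq_pmul2l ?expn_gt0 //; apply: leq_trans.
Qed.

(** As a cycle separates, [F] cannot contain all arcs; its indicator is therefore not constant and
    [boundary_cycle] applies. *)
Lemma face_cycle F : has_cycle G -> F \in faces rot ->
  exists2 c, is_cycle c & {subset c <= F}.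
Proof.
case=> c0 /cycle_separates[g gX [a [b ab]]] Ff.
have [|c cc cF] := boundary_cycle (face_indicator Ff).
  have /subsetPn[x _ xF] : ~~ (setT \subset F).
    apply: contra ab => /subsetP FT; apply/eqP; apply: face_fun_const gX Ff _ _; exact: FT.
  have /imsetP[y _ Fy] := Ff.
  by exists y, x; rewrite !ffunE (negbTE xF) Fy porbit_id.
by exists c => // x /cF; rewrite inE ffunE => /andP[].
Qed.

Lemma size_cycle_sub (c : seq (arc_of G)) (Y : {set arc_of G}) :
  is_cycle c -> {subset c <= Y} -> size c <= #|Y|.
Proof.
by move=> /uniq_cycle/card_uniqP <- cY; apply/subset_leq_card/subsetP.
Qed.

(* Two arcs have the same separators when they lie in the same face of the
   subgraph with edge set X. *)
Definition separators X a := [set g : {ffun arc_of G -> bool} in face_fun X | g a].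

Lemma in_separators X a g : (g \in separators X a) = (g \in face_fun X) && g a.
Proof. by rewrite in_set. Qed.

Lemma separators_indicator X t :
  [ffun a => separators X a == t] \in face_fun X.
Proof.
apply/face_funP; split=> a *; rewrite !ffunE; congr (_ == _); apply/setP=> g;
  rewrite !in_separators;
  by apply: andb_id2l => /face_funP[g1 g2]; rewrite ?g1 ?g2.
Qed.

Lemma separators_const X g a b :
  separators X a = separators X b -> g \in face_fun X -> g a = g b.
Proof. by move=> /setP/(_ g); rewrite !in_separators => e gX; rewrite gX in e. Qed.

(** A function in [face_fun X] is determined by the classes on which it is true. *)
Lemma card_face_fun_classes X :
  #|face_fun X| <= 2 ^ #|[set separators X a | a : arc_of G]|.
Proof.
set C := [set _ | _ in _]; rewrite -card_powerset.
pose s g := [set t in C | g \in t].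
have s_inj : {in face_fun X &, injective s}.
  move=> g1 g2 g1X g2X /setP e; apply/ffunP=> a; have := e (separators X a).
  by rewrite in_set [RHS]in_set !in_separators g1X g2X imset_f.
rewrite -(card_in_imset s_inj); apply/subset_leq_card/subsetP=> _ /imsetP[g _ ->].
by rewrite inE; apply/subsetP=> t; rewrite inE => /andP[].
Qed.

Lemma card_arcs X : #|[set a : arc_of G | a.1 \in X]| = 2 * #|X|.
Proof.
rewrite -sum1_card (eq_bigl (fun a => a.1 \in X)); last by move=> a; rewrite inE.
rewrite big_mkcond sum_arcs /= mulnC -sum_nat_const [RHS]big_mkcond.
by apply: eq_bigr => e _; case: ifP.
Qed.

Lemma card_face_partition (A : {set arc_of G}) d :
  d_angulation G d -> (forall a, (fperm a \in A) = (a \in A)) ->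
  #|A| = d * #|[set F in faces rot | F \subset A]|.
Proof.
move=> dG Af.
have FA a : a \in A -> porbit fperm a \subset A.
  move=> aA; apply/subsetP=> _ /porbitP[i ->].
  by elim: i => [|i IH]; rewrite ?perm1 // expgSr permM Af.
rewrite -sum1_card (partition_big (porbit fperm) (mem [set F in faces rot | F \subset A])) /=.
  rewrite mulnC -sum_nat_const; apply: eq_bigr => F; rewrite inE => /andP[Ff /subsetP FsA].
  rewrite -(dG F Ff) face_degreeE -sum1_card; apply: eq_bigl => a.
  have /imsetP[c _ Fc] := Ff; rewrite Fc eq_porbit_mem -Fc.
  by apply: andb_idl => /FsA.
by move=> a aA; rewrite inE FA // andbT imset_f.
Qed.

Lemma ext_face_ends a : a \in ext_face G ->
  origin a \in ext_vertices G /\ target a \in ext_vertices G.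
Proof.
move=> aF; split; first exact: imset_f.
rewrite -origin_face_perm; apply: imset_f.
have /face_funP[/(_ a)] := face_indicator (ext_face_in G).
by rewrite !ffunE aF.
Qed.

(** * From girth to orientations *)

Section Girth.
Variable d : nat.
Hypotheses (dG : d_angulation G d) (Gc : has_cycle G).
Hypothesis girth : forall c : seq (arc_of G), is_cycle c -> d <= size c.

(** The external boundary walk has d arcs and contains a cycle of at least d arcs, so it repeats
    neither a vertex nor an edge. *)
Lemma card_ext : #|ext_vertices G| = d /\ #|ext_edges G| = d.
Proof.
have [c cc cF] := face_cycle Gc (ext_face_in G).
have dc := girth cc; have dF := dG (ext_face_in G); rewrite face_degreeE in dF.
case/and4P: cc => _ _ uo ue.
have sub (T : finType) (f : arc_of G -> T) :
    uniq [seq f a | a <- c] -> #|[set f a | a in ext_face G]| = d.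
  move=> uf; apply/eqP; rewrite eqn_leq -{1}dF leq_imset_card /=.
  rewrite (leq_trans dc) // -(card_map_arcs uf); apply/subset_leq_card/subsetP.
  by move=> _ /imsetP[a ac ->]; apply: imset_f; apply: cF.
by split; apply: sub.
Qed.

(** Each class of [separators] contains the arcs of a cycle lying on edges of [X], and the classes
    are disjoint among the 2|X| arcs. Including the external edges puts a cycle in [X], so that no
    class is the set of all arcs. *)
Lemma girth_sparse X (S : {set vertex G}) :
  S != set0 -> (forall a, a.1 \in X -> origin a \in S) -> ext_edges G \subset X ->
  d * #|X|.+2 <= 2 * #|X| + d * #|S|.
Proof.
move=> S0 XS extX; have cX := card_face_fun S0 XS.
set C := [set separators X a | a : arc_of G].
have le_C : #|X|.+2 <= #|S| + #|C|.
  rewrite -(leq_exp2l (m := 2)) // expnD (leq_trans cX) // leq_mul //.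
  exact: card_face_fun_classes.
apply: leq_trans (leq_mul (leqnn d) le_C) _; rewrite mulnDr addnC leq_add2r.
rewrite -card_arcs -[leqRHS]sum1_card (partition_big (separators X) (mem C)) /=; last first.
  by move=> a _; apply: imset_f.
rewrite mulnC -sum_nat_const; apply: leq_sum => t /imsetP[a0 _ tE].
have gX := separators_indicator X t.
have [|c cc cY] := boundary_cycle gX.
  have extF : [ffun a => a \in ext_face G] \in face_fun X.
    have /face_funP[h1 h2] := face_indicator (ext_face_in G).
    by apply/face_funP; split=> // a aX; apply: h2; apply: contra aX => /(subsetP extX).
  exists a0; have [/existsP//|/existsPn no] :=
    boolP [exists b, [ffun a => separators X a == t] a0 != [ffun a => separators X a == t] b].
  have sc b : separators X b = separators X a0.
    by have := no b; rewrite !ffunE -tE eqxx negbK => /eqP/esym/eqP.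
  have [c cc cF] := face_cycle Gc (ext_face_in G).
  have [g gc [a [b ab]]] := cycle_separates cc.
  have gX' : g \in face_fun X.
    have /face_funP[h1 h2] := gc.
    apply/face_funP; split=> // x xX; apply: h2; apply: contra xX => /imsetP[y yc ->].
    by apply: (subsetP extX); apply: imset_f; apply: cF.
  by rewrite (separators_const (_ : _ = separators X b) gX') ?eqxx ?sc in ab.
apply: leq_trans (girth cc) _; apply: leq_trans (size_cycle_sub cc cY) _.
rewrite sum1_card; apply/subset_leq_card/subsetP=> a; rewrite !inE !ffunE => /andP[at_ nat_].
rewrite unfold_in inE at_ andbT; apply: contraR nat_ => aX.
by have /face_funP[_ /(_ a aX)] := gX; rewrite !ffunE => ->.
Qed.

(** Only the ratio of [j] to [k] matters, which covers both d/(d-2) and p/(p-1). *)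
Lemma orientation_exists j k :
  2 < d -> d * k = (d - 2) * j -> admits_orientation G j k.
Proof.
move=> d3 dk; have [cV cE] := card_ext.
pose alpha v := if v \in ext_vertices G then 0 else j.
have sum_alpha (U : {set vertex G}) : \sum_(v in U) alpha v = j * #|U :\: ext_vertices G|.
  rewrite mulnC -sum_nat_const big_mkcond [RHS]big_mkcond; apply: eq_bigr => v _.
  by rewrite !inE /alpha; case: (v \in U); case: (v \in ext_vertices G).
have kj m n : (d - 2) * m <= d * n -> k * m <= j * n.
  move=> mn; rewrite -(leq_pmul2l (_ : 0 < d)); last by lia.
  by rewrite mulnA dk mulnCA -mulnA mulnCA leq_mul2l mn orbT.
have [||w wf wo] := @fractional_orientation_exists G k (int_edges G) alpha.
- move=> U; rewrite sum_alpha; apply: kj.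
  (* Adding the external vertices and edges, d of each, turns the bound of [girth_sparse] into one
     on internal vertices and edges. *)
  set U' := U :|: ext_vertices G; set X := induced_edges U'.
  have extX : ext_edges G \subset X.
    apply/subsetP=> _ /imsetP[[e b] /ext_face_ends[o1 o2] ->]; rewrite !inE.
    by case: b o1 o2 => o1; rewrite /target /opp_arc /= => o2; rewrite o1 o2 !orbT.
  have XU a : a.1 \in X -> origin a \in U'.
    by case: a => e b; rewrite inE /= => /andP[]; case: b.
  have U0 : U' != set0.
    have /card_gt0P[v vV] : 0 < #|ext_vertices G| by lia.
    by apply/set0Pn; exists v; rewrite inE vV orbT.
  have := girth_sparse U0 XU extX.
  have -> : #|U'| = #|U :\: ext_vertices G| + d.
    by rewrite -cV -(cardsID (ext_vertices G) U') addnC; congr (_ + _);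
       apply: eq_card => v; rewrite !inE; case: (v \in U); case: (v \in ext_vertices G).
  have : #|induced_edges U :&: int_edges G| + d <= #|X|.
    rewrite -cE -(cardsID (ext_edges G) X) addnC leq_add //.
      by apply/subset_leq_card; rewrite subsetI extX subxx.
    apply/subset_leq_card/subsetP=> e; rewrite !inE => /andP[/andP[-> ->] ->] //.
  move: (#|_ :&: _|) (#|_ :\: _|) (#|X|) => n m x.
  nia.
- have := sum_alpha setT; rewrite (eq_bigl xpredT) => [->|x]; last by rewrite inE.
  (* Euler's formula, with d times the number of faces equal to twice the number of edges. *)
  have eqV : d * #|setT :\: ext_vertices G| = (d - 2) * #|int_edges G|.
    have fT a : (fperm a \in [set: arc_of G]) = (a \in [set: arc_of G]) by rewrite !inE.
    have cA := card_face_partition dG fT.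
    have eF : [set F in faces rot | F \subset setT] = faces rot.
      by apply/setP=> F; rewrite inE subsetT andbT.
    move: cA; rewrite eF; have := card_arcs setT.
    have -> : [set a : arc_of G | a.1 \in [set: edge G]] = setT.
      by apply/setP=> a; rewrite !inE.
    move=> -> {eF}; have := plane_euler G.
    have := cardsC (ext_vertices G); have := cardsC (ext_edges G).
    rewrite setTD -/(int_edges G) cV cE cardsT; nia.
  apply/eqP; rewrite eqn_leq; apply/andP; split; last by apply: kj; rewrite eqV.
  rewrite -(leq_pmul2l (_ : 0 < d)); last by lia.
  by rewrite mulnCA eqV [leqRHS]mulnA dk mulnCA mulnA.
by exists w; split=> // v vE; rewrite wo /alpha ?vE ?(negbTE vE).
Qed.

End Girth.

(** * From orientations to girth *)

Lemma orientation_cycle d (c : seq (arc_of G)) :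
  d_angulation G d -> 2 < d -> admits_orientation G d (d - 2) -> is_cycle c ->
  d <= size c.
Proof.
move=> dG d3 [w [wf wint _]] cc.
set X := [set a.1 | a in c].
have /imsetP[a0 _ extE] : ext_face G \in faces rot := ext_face_in G.
(* The side of [c] away from the external face: all classes except that of the external arc [a0]. *)
have [A AE] : exists A : {set arc_of G},
    forall a, (a \in A) = (separators X a != separators X a0).
  by exists [set a | separators X a != separators X a0] => a; rewrite inE.
have AX : [ffun a => a \in A] \in face_fun X.
  have /face_funP[h1 h2] := separators_indicator X (separators X a0).
  by apply/face_funP; split=> a => [|/h2]; [have := h1 a|]; rewrite !ffunE !AE => ->.
have Af a : (fperm a \in A) = (a \in A).
  by have /face_funP[/(_ a)] := AX; rewrite !ffunE.
have Ar a : (rot a \in A) = (opp_arc a \in A).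
  by have := face_fun_rot a AX; rewrite !ffunE.
have AoX a : a \in A -> opp_arc a \notin A -> a.1 \in X.
  move=> aA; apply: contraR => aX; have /face_funP[_ /(_ a aX)] := AX.
  by rewrite !ffunE aA => ->.
have extA a : a \in ext_face G -> a \notin A.
  move=> aF; have := face_fun_const AX (ext_face_in G) aF (_ : a0 \in _).
  by rewrite !ffunE extE porbit_id => -> //; rewrite AE eqxx.
have A0 : exists a, a \in A.
  have [g gX [a [b ab]]] := cycle_separates cc.
  have [aA|] := boolP (a \in A); first by exists a.
  rewrite AE negbK => /eqP aE; exists b; rewrite AE; apply: contraNneq ab => bE.
  by rewrite (separators_const (_ : _ = separators X b) gX) // aE bE.
(* [Y] is the boundary of the region [A]; [EA] and [VA] are its interior edges and vertices, [X']
   and [S] the edges and vertices of its closure. *)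
pose Y := [set a in A | opp_arc a \notin A].
pose EA := [set e | ((e, false) \in A) && ((e, true) \in A)] : {set edge G}.
pose X' := [set e | ((e, false) \in A) || ((e, true) \in A)] : {set edge G}.
pose FA := [set F in faces rot | F \subset A].
pose S := [set origin a | a in A].
pose VA := [set v in S | [forall a : arc_of G, (origin a == v) ==> (a \in A)]].
have cA : #|A| = d * #|FA| := card_face_partition dG Af.
have cY : #|Y| <= size c.
  have Yinj : {in Y &, injective (fun a => a.1)}.
    move=> a b; rewrite !inE => /andP[aA _] /andP[_ bA] /same_edge[//|ab].
    by move: bA; rewrite -ab aA.
  rewrite -(card_in_imset Yinj); case/and4P: (cc) => _ _ _ /card_map_arcs <-.
  apply/subset_leq_card/subsetP=> _ /imsetP[a aY ->].
  by move: aY; rewrite inE => /andP[]; apply: AoX.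
have sum_card (P : {set arc_of G}) : #|P| = \sum_e (((e, false) \in P) + ((e, true) \in P)).
  by rewrite -(sum_arcs (fun a => (a \in P) : nat)) -sum1_card big_mkcond.
have sum_cardE (P : {set edge G}) : #|P| = \sum_e (e \in P).
  by rewrite -sum1_card big_mkcond.
have cA2 : #|A| = 2 * #|EA| + #|Y|.
  rewrite mul2n -addnn !sum_card !sum_cardE -!big_split /=; apply: eq_bigr => e _.
  rewrite !inE /opp_arc /=.
  by case: (_ \in A); case: (_ \in A).
have cX' : #|X'| = #|EA| + #|Y|.
  rewrite sum_card !sum_cardE -!big_split /=; apply: eq_bigr => e _.
  rewrite !inE /opp_arc /=.
  by case: (_ \in A); case: (_ \in A).
have X'S a : a.1 \in X' -> origin a \in S.
  have XS b : b \in A -> origin b \in S /\ target b \in S.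
    move=> bA; split; first exact: imset_f.
    by rewrite -origin_face_perm; apply: imset_f; rewrite Af.
  by case: a => e b; rewrite in_set /= => /orP[] /XS[]; case: b.
have S0 : S != set0 by case: A0 => a aA; apply/set0Pn; exists (origin a); apply: imset_f.
have := card_face_fun S0 X'S.
(* A function on the faces of the closure is determined by its values on the faces in [A] and one
   exterior value, that at [a0]. *)
have D_le : #|face_fun X'| <= 2 ^ #|FA|.+1.
  rewrite expnS -card_powerset -card_bool -cardsT -cardsX.
  pose s g := (g a0, [set F in FA | F \subset [set a | g a]]).
  have s_inj : {in face_fun X' &, injective s}.
    move=> g1 g2 g1X g2X [e0 /setP eF]; apply/ffunP=> a.
    have [aA|aB] := boolP (a \in A).
      have aF : porbit fperm a \in faces rot by apply: imset_f.
      have aFA : porbit fperm a \in FA.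
        rewrite inE aF; apply/subsetP=> b bF.
        by have := face_fun_const AX aF bF (porbit_id _ a); rewrite !ffunE aA.
      have gF g : g \in face_fun X' -> (porbit fperm a \subset [set b | g b]) = g a.
        move=> gX; apply/subsetP/idP => [/(_ a (porbit_id _ a))|ga b bF]; rewrite inE //.
        by rewrite (face_fun_const gX aF bF (porbit_id _ a)).
      by have := eF (porbit fperm a); rewrite in_set [RHS]in_set aFA /= !gF.
    have gB g : g \in face_fun X' -> g a = g a0.
      (* Made false on [A], [g] no longer changes across edges outside [X], so it is constant on the
         class of [a0]. *)
      move=> gX; pose g' : {ffun arc_of G -> bool} := [ffun b => (b \notin A) && g b].
      have g'X : g' \in face_fun X.
        have /face_funP[h1 h2] := gX; apply/face_funP.
        split=> [b|b bX]; rewrite !ffunE; first by rewrite Af h1.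
        have oA : (opp_arc b \in A) = (b \in A).
          by have /face_funP[_ /(_ b bX)] := AX; rewrite !ffunE.
        rewrite oA; apply: andb_id2l => bA; apply: h2; move: (bA); rewrite -oA.
        by move: bA; case: (b) => e []; rewrite !inE /opp_arc /= => /negbTE-> /negbTE->.
      have := separators_const (_ : separators X a = separators X a0) g'X.
      rewrite !ffunE aB; have -> : a0 \notin A by rewrite AE eqxx.
      by apply; move: aB; rewrite AE negbK => /eqP.
    by rewrite !gB.
  rewrite -(card_in_imset s_inj); apply/subset_leq_card/subsetP=> _ /imsetP[g _ ->].
  by rewrite !inE; apply/subsetP=> F; rewrite inE => /andP[].
move=> /leq_trans/(_ (leq_mul (leqnn _) D_le)); rewrite -expnD leq_exp2l // cX'.
(* A vertex of the closure from which no boundary arc starts is interior, as membership in [A] then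
   propagates around it. *)
have S_le : #|S| <= #|VA| + #|Y|.
  rewrite -(cardsID VA S); apply: leq_add.
    by apply/subset_leq_card; apply: subsetIr.
  apply: leq_trans (leq_imset_card (@origin G) Y); apply/subset_leq_card/subsetP=> v.
  rewrite in_setD [v \in VA]in_set => /andP[+ vS]; rewrite vS => /forallPn[b].
  rewrite negb_imply => /andP[/eqP ob bA]; case/imsetP: (vS) => a aA va.
  have [/existsP[x /andP[xY /eqP <-]]|/existsPn no] :=
    boolP [exists x, (x \in Y) && (origin x == v)]; first exact: imset_f.
  case/negP: bA; apply: (@rot_closed G (mem A) a) => //=; last by rewrite ob.
  move=> x xo xA; have := no x; rewrite xo va eqxx andbT inE xA /= negbK.
  by rewrite -Ar.
(* Interior vertices and edges are not external, and every arc from an interior vertex lies on an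
   interior edge. *)
have VA_le : d * #|VA| <= (d - 2) * #|EA|.
  have EAint : EA \subset int_edges G.
    apply/subsetP=> e; rewrite in_set => /andP[e1 e2]; rewrite inE.
    by apply/imsetP=> -[[e' b] /extA eA /= ee']; move: eA; rewrite -ee'; case: b; rewrite ?e1 ?e2.
  rewrite -(sum_fractional wf EAint).
  have -> : d * #|VA| = \sum_(v in VA) outdegree (int_edges G) w v.
    rewrite mulnC -sum_nat_const; apply: eq_bigr => v.
    rewrite in_set => /andP[_ /forallP vA]; rewrite wint //.
    apply/imsetP=> -[a /extA aA va]; case/negP: aA.
    by apply: (implyP (vA a)); rewrite va.
  rewrite sum_outdegree big_mkcond [leqRHS]big_mkcond; apply: leq_sum => a _.
  case: ifP => // /andP[_]; rewrite in_set => /andP[_ /forallP vA].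
  have aA : a \in A by apply: (implyP (vA a)).
  have oA : opp_arc a \in A by rewrite -Ar; apply: (implyP (vA _)); rewrite origin_rot.
  suff -> : a.1 \in EA by [].
  by rewrite in_set; move: aA oA; case: (a) => e []; rewrite /opp_arc /= => -> ->.
move: cA cA2 cY S_le VA_le d3; nia.
Qed.

End Faces.

Theorem theorem2p1 (d : nat) (G : plane_graph) :
  3 <= d ->
  d_angulation G d ->
  (has_cycle G ->
     (admits_orientation G d (d - 2) <-> has_girth G d)) /\
  (forall p : nat,
     d = 2 * p -> has_girth G d -> admits_orientation G p (p - 1)).
Proof.
move=> d3 dG; split=> [Gc|p dp [[c cc _] girth]].
  split=> [or|[_ girth]]; last by apply: (orientation_exists dG) => //; rewrite mulnC.
  have girth c : is_cycle c -> d <= size c := orientation_cycle dG d3 or.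
  (* The value d is attained: the external face has d arcs, among which are those of a cycle. *)
  split=> //; have [c cc cF] := face_cycle Gc (ext_face_in G).
  exists c => //; apply/eqP; rewrite eqn_leq girth // andbT.
  by rewrite (leq_trans (size_cycle_sub cc cF)) // -face_degreeE dG // ext_face_in.
by apply: (orientation_exists dG) => //; [exists c | nia].
Qed.
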